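(* Let $(X,p)$ be a complete partial $b$-metric space with coefficient $s>1$, $X$ nonempty, and let $T:X\to X$ be a mapping for which there is $\lambda\in\left[0,\frac{1}{s}\right)$ such that $$p(Tx,Ty)\leq\lambda\,\max\{p(x,y),\,p(x,Ty),\,p(y,Tx)\}\quad\text{for all }x,y\in X.$$ Then $T$ has a unique fixed point $u\in X$, and $p(u,u)=0$.
   Context: A partial $b$-metric space with coefficient $s\geq1$ is a pair $(X,p)$ where $X$ is a set and $p:X\times X\to[0,\infty)$ satisfies: (pm1) for all $x,y\in X$, $x=y$ if and only if $p(x,x)=p(x,y)=p(y,y)$; (pm2) $0\leq p(x,x)\leq p(x,y)$ for all $x,y\in X$; (pm3) $p(x,y)=p(y,x)$ for all $x,y\in X$; (pm4) $p(x,y)+p(z,z)\leq s[p(x,z)+p(z,y)]$ for all $x,y,z\in X$. A sequence $(x_n)_{n\ge1}$ in $X$ is $p$-Cauchy if $\lim_{n,m\to\infty}p(x_n,x_m)$ exists and is finite. $(X,p)$ is complete if for every $p$-Cauchy sequence $(x_n)_{n\ge1}$ in $X$ there exists $x\in X$ such that $\lim_{n,m\to\infty}p(x_n,x_m)=\lim_{n\to\infty}p(x,x_n)=p(x,x)$. *)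

(* Defs.v *)
From mathcomp Require Export all_boot all_order all_algebra.
From mathcomp Require Export all_classical all_reals all_analysis.
Export Order.TTheory GRing.Theory Num.Theory.
Export numFieldNormedType.Exports.
Set Implicit Arguments.
Unset Strict Implicit.
Unset Printing Implicit Defensive.
Local Open Scope classical_set_scope.
Local Open Scope ring_scope.

Record partial_b_metric (R : realType) (X : Type) (s : R) (p : X -> X -> R)
    : Prop := {
  pbm_coef : 1 <= s;
  pbm_ge0 : forall x y, 0 <= p x y;
  pm1 : forall x y, x = y <-> p x x = p x y /\ p x y = p y y;
  pm2 : forall x y, 0 <= p x x <= p x y;
  pm3 : forall x y, p x y = p y x;
  pm4 : forall x y z, p x y + p z z <= s * (p x z + p z y)
}.

Definition lim2 (R : realType) (u : nat -> nat -> R) (l : R) : Prop :=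
  u nm.1 nm.2 @[nm --> (\oo, \oo)] --> l.

(* The limit is required to be an element of R, hence finite. *)
Definition p_cauchy (R : realType) (X : Type) (p : X -> X -> R)
    (x_ : nat -> X) : Prop :=
  exists l : R, lim2 (fun n m => p (x_ n) (x_ m)) l.

Definition p_complete (R : realType) (X : Type) (p : X -> X -> R) : Prop :=
  forall x_ : nat -> X, p_cauchy p x_ ->
    exists x : X, lim2 (fun n m => p (x_ n) (x_ m)) (p x x) /\
                  p x (x_ n) @[n --> \oo] --> p x x.

(* Main.v *)
Require Import Defs.
Local Open Scope ring_scope.

(** The terms [p(x,Tx)] and [p(y,Ty)] are absent from the contraction condition.
    So on an orbit [x_n = T^n x_0] the largest of the [p(x_i,x_j)], [i, j <= n],
    is at most [lambda] times itself when [i, j >= 1], and at most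
    [s p(x_0,x_1)] plus [s lambda] times itself when [i = 0]. As [s lambda < 1],
    the orbit is bounded by some [C], hence [p(x_i,x_j) <= lambda^m C] for
    [i, j >= m], and the orbit converges to a point [u] with [p(u,u) = 0].
    Estimating [p(u,Tu)] directly would cost a factor [s^2 lambda]. Instead
    [a_n = p(x_n,Tu)] satisfies [a_(n+1) <= lambda max(e_n,a_n)] with
    [e_n -> 0], so [a_n -> 0] and [p(u,Tu) <= s (p(u,x_n) + a_n) -> 0]. *)

Set Implicit Arguments.
Unset Strict Implicit.
Unset Printing Implicit Defensive.

Section QuasiContraction.
Local Open Scope classical_set_scope.

(** Once [e] stays below [eps / 2] from [N] on, bounding the maximum by a sum gives
    [a (N + k) <= eps / 2 + a N * lambda ^+ k] by induction; the error does not accumulate because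
    [lambda <= 1]. *)
Lemma cvg0_contractive_max (R : realType) (lambda : R) (a e : nat -> R) :
  0 <= lambda < 1 -> (forall n, 0 <= a n) ->
  (forall n, a n.+1 <= lambda * Num.max (e n) (a n)) ->
  (e n @[n --> \oo] --> 0) -> a n @[n --> \oo] --> 0.
Proof.
move=> /andP[l0 l1] a0 ha /cvgrPdist_le he.
apply/cvgrPdist_le => eps eps0.
have eps2 : 0 < eps / 2 by rewrite divr_gt0.
have [N _ hN] := he _ eps2.
have bnd k : a (N + k)%N <= eps / 2 + a N * lambda ^+ k.
  elim: k => [|k IH]; first by rewrite addn0 expr0 mulr1 lerDr ltW.
  have aNk : 0 <= a N * lambda ^+ k by rewrite mulr_ge0 ?exprn_ge0.
  rewrite addnS (le_trans (ha _))//.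
  apply: (@le_trans _ _ (lambda * (eps / 2 + a N * lambda ^+ k))).
    rewrite ler_wpM2l// ge_max IH andbT.
    have := hN (N + k)%N (leq_addr _ _); rewrite sub0r normrN => hk.
    by rewrite (le_trans (ler_norm _))// (le_trans hk)// lerDl.
  by rewrite mulrDr exprS [a N * (_ * _)]mulrCA lerD2r ler_piMl// ltW.
have geo : a N * lambda ^+ k @[k --> \oo] --> 0.
  by apply: cvg_geometric; rewrite ger0_norm.
have /cvgrPdist_le/(_ _ eps2)[K _ hK] := geo.
exists (N + K)%N => // n /= hn.
have Nn : (N <= n)%N by rewrite (leq_trans _ hn)// leq_addr.
rewrite sub0r normrN ger0_norm//.
have := bnd (n - N)%N; rewrite subnKC// => /le_trans; apply.
have := hK (n - N)%N; rewrite /= leq_subRL// => /(_ hn).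
rewrite sub0r normrN => /(le_trans (ler_norm _)) h.
by rewrite [leRHS]splitr lerD2l.
Qed.

Variables (R : realType) (X : Type) (s : R) (p : X -> X -> R).
Variables (T : X -> X) (lambda : R).
Hypotheses (hp : partial_b_metric s p).
Hypotheses (lambda0 : 0 <= lambda) (sl1 : s * lambda < 1).
Hypothesis hT : forall x y : X,
  p (T x) (T y) <= lambda * Num.max (p x y) (Num.max (p x (T y)) (p y (T x))).

Let p0 x y : 0 <= p x y := pbm_ge0 hp x y.
Let pC x y : p x y = p y x := pm3 hp x y.
Let s1 : 1 <= s := pbm_coef hp.
Let s0 : 0 <= s. Proof. exact: le_trans ler01 s1. Qed.

Lemma pbm_triangle x y z : p x y <= s * (p x z + p z y).
Proof. by rewrite (le_trans _ (pm4 hp x y z))// lerDl. Qed.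

(** Both self-distances lie between 0 and [p x y], so all three values in (pm1) vanish. *)
Lemma pbm_eq0 x y : p x y = 0 -> x = y.
Proof.
move=> xy0; apply/(pm1 hp).
have /andP[_ xx] := pm2 hp x y; have /andP[_ yy] := pm2 hp y x.
rewrite pC xy0 in yy; rewrite xy0 in xx *.
by split; apply/le_anti; rewrite ?xx ?yy ?p0.
Qed.

Lemma lambda_lt1 : lambda < 1.
Proof. by rewrite (le_lt_trans _ sl1)// ler_peMl. Qed.

Lemma le_contraction M x y : p x y <= M -> p x (T y) <= M -> p y (T x) <= M ->
  p (T x) (T y) <= lambda * M.
Proof.
by move=> h1 h2 h3; rewrite (le_trans (hT _ _))// ler_wpM2l// !ge_max h1 h2 h3.
Qed.

Lemma orbit_bounded x : exists C : R, forall i j,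
  p (iter i T x) (iter j T x) <= C.
Proof.
pose q i j := p (iter i T x) (iter j T x).
have qC i j : q i j = q j i by exact: pC.
(* This constant, independent of [i] and [j], comes from solving [M <= s * q 0 1 + s * lambda * M]
   for [M]. *)
exists (s * q 0 1 / (1 - s * lambda)) => i j.
pose n := maxn i j.
pose M := \big[Num.max/0]_(k : 'I_n.+1 * 'I_n.+1) q k.1 k.2.
have qM a b : (a <= n)%N -> (b <= n)%N -> q a b <= M.
  move=> an bn.
  exact: (le_bigmax _ (fun k : 'I_n.+1 * 'I_n.+1 => q k.1 k.2)
    (Ordinal (an : (a < n.+1)%N), Ordinal (bn : (b < n.+1)%N))).
have M0 : 0 <= M by rewrite (le_trans (p0 x x))// (qM 0%N 0%N).
have qSS a b : (a < n)%N -> (b < n)%N -> q a.+1 b.+1 <= lambda * M.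
  move=> an bn; apply: le_contraction.
  - exact: (qM a b (ltnW an) (ltnW bn)).
  - exact: (qM a b.+1 (ltnW an) bn).
  - exact: (qM b a.+1 (ltnW bn) an).
have q0 b : (b <= n)%N -> q 0%N b <= s * q 0 1 + s * lambda * M.
  case: b => [|b] bn.
    (* The self-distance [q 0 0] may be nonzero; (pm2) bounds it by [q 0 1]. *)
    have /andP[_ h] := pm2 hp x (T x).
    rewrite (le_trans h)// -[leLHS]addr0 lerD ?mulr_ge0//.
    by rewrite ler_peMl// p0.
  (* Passing through [T x] leaves [q 1 b.+1], to which the contraction applies. *)
  rewrite (le_trans (pbm_triangle _ _ (T x)))// mulrDr lerD2l -mulrA ler_wpM2l//.
  by apply: (qSS 0%N b) => //; apply: leq_trans bn.
have ub : M <= s * q 0 1 + s * lambda * M.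
  apply: bigmax_le => [|[[[|a] an] [[|b] bn]] _] /=.
  - by rewrite addr_ge0 ?mulr_ge0 ?p0.
  - exact: q0.
  - exact: q0.
  - by rewrite qC; exact: q0.
  - rewrite (le_trans (qSS _ _ _ _))// -[leLHS]add0r lerD ?mulr_ge0 ?p0//.
    by rewrite -mulrA ler_peMl// mulr_ge0.
apply: (@le_trans _ _ M); first by apply: qM; rewrite leq_max leqnn ?orbT.
by rewrite ler_pdivlMr ?subr_gt0// mulrBr mulr1 lerBlDr [M * _]mulrC.
Qed.

(** Lowering both indices by one gains a factor [lambda]; the mixed terms keep both indices at least
    [m], so induction covers them. *)
Lemma orbit_geometric x C : (forall i j, p (iter i T x) (iter j T x) <= C) ->
  forall m i j, (m <= i)%N -> (m <= j)%N ->
    p (iter i T x) (iter j T x) <= C * lambda ^+ m.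
Proof.
move=> hC; elim=> [|m IH] i j; first by rewrite expr0 mulr1.
case: i => // i; case: j => // j; rewrite !ltnS => mi mj.
rewrite exprS mulrCA; apply: le_contraction.
- exact: IH.
- by apply: (IH i j.+1) => //; rewrite leqW.
- by apply: (IH j i.+1) => //; rewrite leqW.
Qed.

Lemma orbit_lim2 x : lim2 (fun n m => p (iter n T x) (iter m T x)) 0.
Proof.
have [C hC] := orbit_bounded x.
have geo : C * lambda ^+ k @[k --> \oo] --> 0.
  by apply: cvg_geometric; rewrite ger0_norm// lambda_lt1.
apply/cvgrPdist_le => eps eps0.
have /cvgrPdist_le/(_ _ eps0)[K _ hK] := geo.
exists ([set n | (K <= n)%N], [set n | (K <= n)%N]).
  by split; exists K.
move=> [i j] [/= Ki Kj].
rewrite sub0r normrN ger0_norm// (le_trans (orbit_geometric hC Ki Kj))//.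
by have := hK K (leqnn K); rewrite sub0r normrN; exact/le_trans/ler_norm.
Qed.

Lemma orbit_limit_fixed x u :
  (p u (iter n T x) @[n --> \oo] --> 0) -> T u = u.
Proof.
move=> hu.
have hu1 : p u (iter n.+1 T x) @[n --> \oo] --> 0.
  by rewrite -(cvg_shiftS (fun n => p u (iter n T x))) in hu.
(* This sum serves as [e_n]: it dominates both [p u x_n] and [p u (T x_n)], and the third term of
   the maximum is [a_n] itself. *)
have hsum : p u (iter n T x) + p u (iter n.+1 T x) @[n --> \oo] --> 0.
  by rewrite -[X in _ --> X]addr0; exact: cvgD.
have ha : p (iter n T x) (T u) @[n --> \oo] --> 0.
  apply: (cvg0_contractive_max (lambda := lambda) _ _ _ hsum) => //.
    by rewrite lambda0 lambda_lt1.
  move=> n; apply: le_contraction.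
  - by rewrite le_max pC lerDl p0.
  - by rewrite le_max lexx orbT.
  - by rewrite le_max lerDr p0.
have hlim : s * (p u (iter n T x) + p (iter n T x) (T u)) @[n --> \oo] --> 0.
  rewrite -[X in _ --> X](mulr0 s) -[X in s * X]addr0.
  by apply: cvgMr; exact: cvgD.
apply/esym/pbm_eq0/le_anti; rewrite p0 andbT.
apply: (cvgr_to_ge hlim); apply: nearW => n; exact: pbm_triangle.
Qed.

(** At two fixed points all three terms of the maximum equal [p v u], and [lambda < 1] forces it to
    be 0. *)
Lemma fixed_point_unique u v : T u = u -> T v = v -> v = u.
Proof.
move=> Tu Tv; apply: pbm_eq0; apply/le_anti; rewrite p0 andbT.
have : p v u <= lambda * p v u.
  by rewrite -{1}Tv -{1}Tu; apply: le_contraction; rewrite ?Tu ?Tv// pC.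
rewrite -subr_ge0 -{2}[p v u]mul1r -mulrBl nmulr_rge0//.
by rewrite subr_lt0 lambda_lt1.
Qed.

End QuasiContraction.

Theorem theorem3p2 (R : realType) (X : Type) (s : R) (p : X -> X -> R)
    (T : X -> X) (lambda : R)
    (hX : inhabited X)
    (hs : 1 < s)
    (hp : partial_b_metric s p)
    (hcomplete : p_complete p)
    (hlambda0 : 0 <= lambda)
    (hlambda1 : lambda < 1 / s)
    (hT : forall x y : X,
      p (T x) (T y) <=
        lambda * Num.max (p x y) (Num.max (p x (T y)) (p y (T x)))) :
  exists u : X,
    [/\ T u = u, (forall v : X, T v = v -> v = u) & p u u = 0].
Proof.
case: hX => x.
have sl1 : s * lambda < 1.
  by rewrite mulrC -ltr_pdivlMr// (lt_trans ltr01).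
have lim0 := orbit_lim2 hp hlambda0 sl1 hT x.
have [u [limu hu]] := hcomplete _ (ex_intro _ _ lim0).
(* Completeness makes [p u u] the double limit of the orbit distances, already known to be 0. *)
have uu : p u u = 0 by apply: (cvg_unique _ limu lim0).
rewrite uu in hu.
have Tu := orbit_limit_fixed hp hlambda0 sl1 hT hu.
by exists u; split => // v; exact: (fixed_point_unique hp hlambda0 sl1 hT Tu).
Qed.
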